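(* Let $a_1,\dots,a_6,b_1,\dots,b_6,c_1,c_2,c_3$ be nonzero variables of the seed with the $\mathcal A_6$-quiver described in the context, with $c_1\neq-1$, and let primes denote the variables obtained by the cluster mutation at $c_1$. Then: (i) the reduction conditions $c_1c_2c_3=1$ and $1+\frac1{c_2}+\frac1{c_2c_3}=0$ are equivalent to $c_2'c_3'=1$ and $\bigl(1+\frac1{c_1'}\bigr)\bigl(1+\frac1{c_2'}\bigr)=0$, and their solution (since $c_1'\ne-1$) is $c_2'=c_3'=-1$; (ii) on the locus $c_2'=c_3'=-1$, setting $\widetilde b_1=-c_1'b_1'$ and $\widetilde b_4=-c_1'b_4'$, the six elementary geodesic functions $$\langle a_6b_5c_3b_1a_1\rangle,\ \langle a_1b_6c_1b_2a_2\rangle,\ \langle a_2b_1c_2b_3a_3\rangle,\ \langle a_3b_2c_3b_4a_4\rangle,\ \langle a_4b_3c_1b_5a_5\rangle,\ \langle a_5b_4c_2b_6a_6\rangle$$ are equal, respectively, to $$\langle a_6'b_5'\widetilde b_1a_1'\rangle,\ \langle a_1'b_6'b_2'a_2'\rangle,\ \langle a_2'\widetilde b_1b_3'a_3'\rangle,\ \langle a_3'b_2'\widetilde b_4a_4'\rangle,\ \langle a_4'b_3'b_5'a_5'\rangle,\ \langle a_5'\widetilde b_4b_6'a_6'\rangle$$ (the radicands on the two sides coincide and the same square root is taken on both sides); (iii) $c_2'$ and $c_3'$ Poisson commute with the twelve variables $a_1',\dots,a_6',\widetilde b_1,b_2',b_3',\widetilde b_4,b_5',b_6'$, and the Poisson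 bracket of these twelve variables is the log-canonical bracket of the quiver with arrows (writing $\beta_1=\widetilde b_1$, $\beta_4=\widetilde b_4$, $\beta_i=b_i'$ for $i=2,3,5,6$, indices modulo $6$) $a_i'\to a_{i+1}'$, $a_{i+1}'\to\beta_i$, $\beta_i\to a_i'$, $\beta_i\to\beta_{i+2}$ for all $i$; (iv) this quiver is the adjacency quiver of a trivalent ribbon graph of genus $2$ with $2$ boundary components, the vertices of the quiver corresponding to the edges of the ribbon graph.
   Context: The $\mathcal A_6$-quiver has vertices $a_i,b_i$ ($i\in\mathbb Z/6$) and $c_1,c_2,c_3$, and arrows $a_i\to a_{i+1}$, $b_i\to b_{i+1}$, $a_{i+1}\to b_i$, $b_i\to a_i$ for all $i$ modulo $6$, together with $b_6\to c_1\to b_5$, $b_3\to c_1\to b_2$, $b_4\to c_2\to b_3$, $b_1\to c_2\to b_6$, $b_2\to c_3\to b_1$, $b_5\to c_3\to b_4$, and $c_1\to c_2\to c_3\to c_1$. Write $B_{ij}$ for the number of arrows from vertex $i$ to vertex $j$ minus the number from $j$ to $i$; the log-canonical Poisson bracket of a quiver is $\{x_i,x_j\}=B_{ij}x_ix_j$. Mutation at vertex $k$: the quiver changes by (1) adding an arrow $i\to j$ for each path $i\to k\to j$, (2) reversing all arrows at $k$, (3) cancelling oriented 2-cycles; the variables change by $x_k'=x_k^{-1}$ and $x_i'=x_i\bigl(1+x_k^{-\operatorname{sgn}(B_{ik})}\bigr)^{-B_{ik}}$ for $i\ne k$. Notation: $\langle z_1z_2\cdots z_m\rangle:=(z_1z_2\cdots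 z_m)^{1/2}\Bigl(1+\frac1{z_1}+\frac1{z_1z_2}+\dots+\frac1{z_1z_2\cdots z_m}\Bigr)$. A ribbon graph is a graph with a cyclic order on the half-edges at each vertex. The adjacency quiver of a trivalent ribbon graph has the edges of the graph as vertices, and for each vertex of the ribbon graph and each incident half-edge of an edge $e$ an arrow from $e$ to the edge whose half-edge immediately follows in the cyclic order. The genus and number of boundary components of a ribbon graph are those of its thickening. *)

(* Defs.v *)
From HB Require Import structures.
From mathcomp Require Import all_boot all_order all_fingroup all_algebra.

Set Implicit Arguments.
Unset Strict Implicit.
Unset Printing Implicit Defensive.

Import Order.TTheory GRing.Theory Num.Theory.
Local Open Scope ring_scope.

(* [q i j] is the number of arrows from i to j. *)
Definition quiver (V : eqType) := V -> V -> nat.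

Definition quiver_of_arrows (V : eqType) (s : seq (V * V)) : quiver V :=
  fun i j => count_mem (i, j) s.

Definition exchange (V : eqType) (q : quiver V) (i j : V) : int :=
  (q i j)%:Z - (q j i)%:Z.

Record seed (V : eqType) (K : fieldType) := Seed {
  seed_quiver : quiver V;
  seed_var : V -> K
}.

Section Mutation.
Variables (V : eqType) (k : V).

Definition add_paths (q : quiver V) : quiver V :=
  fun i j => (q i j + q i k * q k j)%N.

Definition reverse_at (q : quiver V) : quiver V :=
  fun i j => if (i == k) || (j == k) then q j i else q i j.

(* Truncated subtraction. *)
Definition cancel_2cycles (q : quiver V) : quiver V :=
  fun i j => (q i j - q j i)%N.

Definition mutate_quiver (q : quiver V) : quiver V :=
  cancel_2cycles (reverse_at (add_paths q)).

Definition mutate_var (K : fieldType) (q : quiver V) (x : V -> K) : V -> K :=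
  fun i => if i == k then (x k)^-1
           else x i * (1 + x k ^ (- sgz (exchange q i k))) ^ (- exchange q i k).

Definition mutate (K : fieldType) (s : seed V K) : seed V K :=
  Seed (mutate_quiver (seed_quiver s))
       (mutate_var (seed_quiver s) (seed_var s)).

End Mutation.

(* Poisson brackets over the ground ring Z: a bracket that is bilinear over a
   larger ground field is in particular biadditive. *)
Record is_poisson (K : fieldType) (pb : K -> K -> K) : Prop := IsPoisson {
  poissonDl : forall f g h, pb (f + g) h = pb f h + pb g h;
  poissonDr : forall f g h, pb f (g + h) = pb f g + pb f h;
  poisson_alt : forall f, pb f f = 0;
  poisson_leibniz : forall f g h, pb f (g * h) = pb f g * h + g * pb f h;
  poisson_jacobi : forall f g h,
    pb f (pb g h) + pb g (pb h f) + pb h (pb f g) = 0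
}.

Definition log_canonical (V : eqType) (K : fieldType) (pb : K -> K -> K)
    (q : quiver V) (x : V -> K) : Prop :=
  forall i j, pb (x i) (x j) = (exchange q i j)%:~R * x i * x j.

(* <z_1 ... z_m>, where [s] is the chosen square root of z_1 ... z_m. *)
Definition geodesic (K : fieldType) (s : K) (z : seq K) : K :=
  s * \sum_(0 <= k < (size z).+1) (\prod_(t <- take k z) t)^-1.

(* <z> = <w> with the same square root of the common radicand on both sides. *)
Definition geodesic_eq (K : fieldType) (z w : seq K) : Prop :=
  \prod_(t <- z) t = \prod_(t <- w) t /\
  forall s, s ^+ 2 = \prod_(t <- z) t -> geodesic s z = geodesic s w.

(* Indices are residues, so that index 6 is 0 : 'Z_6 and index 3 of a
   c-vertex is 0 : 'Z_3. *)
Definition indices6 : seq 'Z_6 := [:: 1; 2; 3; 4; 5; 6].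

Definition A6_vertex : finType := ('Z_6 + 'Z_6 + 'Z_3)%type.
Definition A6a (i : 'Z_6) : A6_vertex := inl (inl i).
Definition A6b (i : 'Z_6) : A6_vertex := inl (inr i).
Definition A6c (i : 'Z_3) : A6_vertex := inr i.

Definition A6_quiver : quiver A6_vertex := quiver_of_arrows (
  [seq (A6a i, A6a (i + 1)) | i <- indices6] ++
  [seq (A6b i, A6b (i + 1)) | i <- indices6] ++
  [seq (A6a (i + 1), A6b i) | i <- indices6] ++
  [seq (A6b i, A6a i) | i <- indices6] ++
  [:: (A6b 6, A6c 1); (A6c 1, A6b 5); (A6b 3, A6c 1); (A6c 1, A6b 2);
      (A6b 4, A6c 2); (A6c 2, A6b 3); (A6b 1, A6c 2); (A6c 2, A6b 6);
      (A6b 2, A6c 3); (A6c 3, A6b 1); (A6b 5, A6c 3); (A6c 3, A6b 4);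
      (A6c 1, A6c 2); (A6c 2, A6c 3); (A6c 3, A6c 1)]).

Definition red_vertex : finType := ('Z_6 + 'Z_6)%type.
Definition reda (i : 'Z_6) : red_vertex := inl i.
Definition redbeta (i : 'Z_6) : red_vertex := inr i.

Definition red_quiver : quiver red_vertex := quiver_of_arrows (
  [seq (reda i, reda (i + 1)) | i <- indices6] ++
  [seq (reda (i + 1), redbeta i) | i <- indices6] ++
  [seq (redbeta i, reda i) | i <- indices6] ++
  [seq (redbeta i, redbeta (i + 2)) | i <- indices6]).

(* [rg_next] sends a half-edge to its successor in the cyclic order at its
   vertex, and [rg_opp] exchanges the two half-edges of each edge. *)
Record ribbon_graph := RibbonGraph {
  rg_vert : finType;
  rg_edge : finType;
  rg_half : finType;
  rg_vert_of : rg_half -> rg_vert;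
  rg_edge_of : rg_half -> rg_edge;
  rg_next : {perm rg_half};
  rg_opp : {perm rg_half};
  rg_nextP : forall h,
    porbit rg_next h = [set h' | rg_vert_of h' == rg_vert_of h];
  rg_oppP : forall h,
    porbit rg_opp h = [set h' | rg_edge_of h' == rg_edge_of h];
  rg_edge_card : forall e, #|[set h | rg_edge_of h == e]| = 2%N
}.

Definition trivalent (G : ribbon_graph) : Prop :=
  forall v : rg_vert G, #|[set h | rg_vert_of h == v]| = 3%N.

Definition adjacency_quiver (G : ribbon_graph) : quiver (rg_edge G) :=
  fun e e' => #|[set h | (rg_edge_of h == e) &&
                         (rg_edge_of (rg_next G h) == e')]|.

Definition rg_adj (G : ribbon_graph) : rel (rg_vert G) :=
  fun v w => [exists h, (rg_vert_of h == v) &&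
                        (rg_vert_of (rg_opp G h) == w)].

Definition rg_connected (G : ribbon_graph) : Prop :=
  (0 < #|rg_vert G|)%N /\ forall v w, connect (@rg_adj G) v w.

(* A boundary component of the thickening runs along an edge to its other
   half-edge and then turns to the next half-edge at the vertex reached (every
   vertex is assumed to carry a half-edge). *)
Definition boundary_number (G : ribbon_graph) : nat :=
  #|porbits (rg_opp G * rg_next G)%g|.

(* The thickening is a compact connected oriented surface that retracts onto
   the graph, so its genus g is determined by V - E = 2 - 2 g - s, where s is
   the number of boundary components. *)
Definition has_genus (G : ribbon_graph) (g : nat) : Prop :=
  rg_connected G /\
  #|rg_vert G|%:Z - #|rg_edge G|%:Z = 2 - 2 * g%:Z - (boundary_number G)%:Z.

(* Main.v *)
Require Import Defs.
From HB Require Import structures.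
From mathcomp Require Import all_boot all_order all_fingroup all_algebra.
From mathcomp Require Import ring.

Set Implicit Arguments.
Unset Strict Implicit.
Unset Printing Implicit Defensive.

Import Order.TTheory GRing.Theory Num.Theory.
Local Open Scope ring_scope.

(** Write c for the variable at c_1 and B_i for the signed number of arrows
from the vertex i to c_1.  Since 1 + 1/c = (1 + c)/c, mutation at c_1 gives

  x_i' = x_i c^max(B_i, 0) (1 + c)^(-B_i)  for i other than c_1,

which is [mutate_varE].  In particular c_2' = c_2 (1 + c), c_3' = c_3 c/(1 + c),
and part (i) is a computation: c_2' c_3' = c_1 c_2 c_3, and where this product
is 1 the two second conditions have the same left-hand side.

On the locus c_2' = c_3' = -1 both c_2 and c_3 are functions of c.  A geodesic
function is the square root of the product times the nested sum
1 + z_1^-1 (1 + z_2^-1 (1 + ...)), and three consecutive entries u, w, v of its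
word enter that sum only through u^-1 (1 + w^-1) and u w v.  They can therefore
be contracted to two entries u', v' as soon as u'^-1 = u^-1 (1 + w^-1) and
u' v' = u w v ([geodesic_contract]).  In each of the six words the three middle
entries b, c_j, b contract to the two new ones.

For the brackets, take any family z_i = +- x_i c^(m_i) (1 + c)^(-B_i).  The
factor multiplying x_i depends on c only, so its bracket with h is governed by
its logarithmic derivative in c, which is m_i/c - B_i/(1 + c).  In {z_i, z_j}
the contributions of the powers of 1 + c are B_i B_j c/(1 + c) with both signs
and cancel, so the z_i are log-canonical with integral coefficients
B_ij + m_j B_i - m_i B_j ([poisson_twist]).  All variables in (iii) are of this
form, with m_i = max(B_i, 0), lowered by one for the two rescaled variables
-c_1' b_1' and -c_1' b_4'; it remains to compare two finite tables of integers
([red_exchange], [red_exchange_c]).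

The 24 arrows of the reduced quiver form eight oriented triangles: the six
a_i -> a_(i+1) -> beta_i -> a_i, and the two made of the beta_i with i odd and
with i even.  Every quiver vertex lies in exactly two of them, so the triangles
are the vertices and the quiver vertices the edges of a trivalent ribbon graph.
Its boundary has two components, of 6 and 18 steps, and 8 - 12 = 2 - 2 * 2 - 2
gives genus 2. *)

(** * Mutated variables *)

Definition pos_part (n : int) : int := if 0 <= n then n else 0.

(** The two sign cases of the mutation rule merge, because
(1 + x_k^-1)^-n = x_k^n (1 + x_k)^-n. *)
Lemma mutate_varE (V : eqType) (K : fieldType) (k : V) (q : quiver V)
    (x : V -> K) (i : V) :
  x k != 0 -> i != k ->
  mutate_var k q x i =
    x i * (x k ^ pos_part (exchange q i k) * (1 + x k) ^ (- exchange q i k)).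
Proof.
move=> xk0 /negPf ik; rewrite /mutate_var ik; congr (_ * _).
case: (exchange q i k) => [[|n]|n] /=.
- by rewrite /pos_part oppr0 !expr0z mulr1.
- rewrite /sgz /pos_part /=.
  rewrite -[- _.+1%:Z]/(Negz n) /=.
  have -> : 1 + x k ^ (- 1) = (x k)^-1 * (1 + x k).
    by rewrite exprN1 mulrDr mulr1 mulVf // addrC.
  by rewrite /exprz exprMn invfM exprVn invrK.
- rewrite /sgz /pos_part /=.
  by rewrite opprK expr1z expr0z mul1r.
Qed.

(** * Poisson brackets of rescaled variables *)

Section Poisson.
Variables (K : fieldType) (pb : K -> K -> K) (pbP : is_poisson pb).

Lemma poisson_anti f g : pb f g = - pb g f.
Proof.
apply/eqP; rewrite -addr_eq0; apply/eqP.
have := poisson_alt pbP (f + g).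
by rewrite !(poissonDl pbP, poissonDr pbP) !(poisson_alt pbP) add0r addr0.
Qed.

Lemma poissonMl f g h : pb (f * g) h = f * pb g h + pb f h * g.
Proof.
rewrite poisson_anti (poisson_leibniz pbP) (poisson_anti h f) (poisson_anti h g).
ring.
Qed.

Lemma poisson1l h : pb 1 h = 0.
Proof.
have := poissonMl 1 1 h; rewrite !mulr1 mul1r => /eqP.
by rewrite -subr_eq subrr eq_sym => /eqP.
Qed.

Lemma poissonNl f h : pb (- f) h = - pb f h.
Proof.
have p0 : pb 0 h = 0.
  have /eqP := poissonDl pbP 0 0 h.
  by rewrite addr0 -subr_eq subrr eq_sym => /eqP.
by apply/eqP; rewrite -addr_eq0 -(poissonDl pbP) addNr p0.
Qed.

(** The behaviour, under brackets, of a function f of c whose logarithmic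
derivative is d: its brackets are determined by those of c. *)
Definition log_der (c f d : K) : Prop := forall h, pb f h = f * d * pb c h.

Lemma log_derM c f g d e :
  log_der c f d -> log_der c g e -> log_der c (f * g) (d + e).
Proof. by move=> fd ge h; rewrite poissonMl fd ge; ring. Qed.

(** Bracketing f f^-1 = 1 with h determines the bracket of f^-1. *)
Lemma log_derV c f d : f != 0 -> log_der c f d -> log_der c f^-1 (- d).
Proof.
move=> f0 fd h; apply: (mulfI f0).
have := poissonMl f f^-1 h; rewrite divff // poisson1l fd => /eqP.
rewrite eq_sym addr_eq0 => /eqP ->.
by field.
Qed.

Lemma log_derX c f d (n : nat) : log_der c f d -> log_der c (f ^+ n) (n%:R * d).
Proof.
move=> fd; elim: n => [|n IHn].
  by move=> h; rewrite expr0 poisson1l; ring.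
by rewrite exprS -addn1 natrD mulrDl mul1r addrC; apply: log_derM.
Qed.

Lemma log_derXz c f d (n : int) :
  f != 0 -> log_der c f d -> log_der c (f ^ n) (n%:~R * d).
Proof.
move=> f0 fd; case: n => n; first exact: log_derX.
rewrite NegzE -invr_expz mulrNz mulNr.
by apply: log_derV; rewrite ?expf_neq0 //; apply: log_derX.
Qed.

Lemma log_der_sign c (n : nat) : log_der c ((-1) ^+ n) 0.
Proof.
have N1 : log_der c (-1) 0 by move=> h; rewrite poissonNl poisson1l; ring.
by rewrite -(mulr0 n%:R); apply: log_derX.
Qed.

Lemma log_derD1 c : 1 + c != 0 -> log_der c (1 + c) (1 + c)^-1.
Proof. by move=> c1 h; rewrite (poissonDl pbP) poisson1l divff // add0r mul1r. Qed.

Lemma log_der_id c : c != 0 -> log_der c c c^-1.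
Proof. by move=> c0 h; rewrite divff // mul1r. Qed.

Variables (V : eqType) (q : quiver V) (x : V -> K).
Hypothesis pbx : log_canonical pb q x.

(** Of the four terms of the Leibniz expansion, the one with {f_i, f_j} vanishes,
since both factors are functions of c and {c, c} = 0. *)
Lemma poisson_rescale c i j fi fj di dj (bi bj : K) :
    log_der c fi di -> log_der c fj dj ->
    pb (x i) c = bi * x i * c -> pb (x j) c = bj * x j * c ->
  pb (x i * fi) (x j * fj) =
    ((exchange q i j)%:~R + c * dj * bi - c * di * bj) * (x i * fi) * (x j * fj).
Proof.
move=> fdi fdj xic xjc.
rewrite poissonMl fdi !(poisson_leibniz pbP) pbx (poisson_anti (x i) fj).
rewrite (poisson_anti c (x j)) (poisson_anti c fj) !fdj.
by rewrite (poisson_anti c (x i)) xic xjc (poisson_alt pbP); ring.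
Qed.

(** The exponent of 1 + x_k is the one forced by mutation at k; the sign and the
power of x_k are left free, so that the mutated variables and their multiples by
-x_k^-1 are both covered. *)
Definition twist (k : V) (e : V -> nat) (m : V -> int) (i : V) : K :=
  x i * ((-1) ^+ e i * (x k ^ m i * (1 + x k) ^ (- exchange q i k))).

(** The non-constant terms of the coefficient, which come from the powers of
1 + x_k, are symmetric in i and j and enter with opposite signs. *)
Lemma poisson_twist k e m i j : x k != 0 -> 1 + x k != 0 ->
  pb (twist k e m i) (twist k e m j) =
    (exchange q i j + m j * exchange q i k - m i * exchange q j k)%:~R
      * twist k e m i * twist k e m j.
Proof.
move=> xk0 xk1.
have ld l : log_der (x k)
    ((-1) ^+ e l * (x k ^ m l * (1 + x k) ^ (- exchange q l k)))
    (0 + ((m l)%:~R * (x k)^-1 + (- exchange q l k)%:~R * (1 + x k)^-1)).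
  apply: log_derM; first exact: log_der_sign.
  apply: log_derM; apply: log_derXz => //; first exact: log_der_id.
  exact: log_derD1.
rewrite /twist (poisson_rescale (ld i) (ld j) (pbx i k) (pbx j k)).
congr (_ * _ * _); rewrite intrB intrD !intrM !mulrNz; field.
by rewrite xk0 xk1.
Qed.

End Poisson.

(** * Geodesic functions *)

Section Geodesic.
Variable K : fieldType.

(** The sum in a geodesic function in nested (Horner) form, which makes it local
in the word. *)
Fixpoint geod_sum (z : seq K) : K :=
  if z is t :: z' then 1 + t^-1 * geod_sum z' else 1.

Lemma geodesicE s (z : seq K) : geodesic s z = s * geod_sum z.
Proof.
rewrite /geodesic; congr (_ * _).
elim: z => [|t z IHz] /=.
  by rewrite big_nat1 big_nil invr1.
rewrite big_nat_recl //= big_nil invr1 -IHz mulr_sumr; congr (1 + _).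
by apply: eq_bigr => k _; rewrite big_cons invfM.
Qed.

(** The nested sum starting at u reads 1 + u^-1 (1 + w^-1) + (u w v)^-1 R, where R
is the sum of the rest of the word, and the one starting at u' reads
1 + u'^-1 + (u' v')^-1 R. *)
Lemma geodesic_contract (l r : seq K) u w v u' v' :
    u'^-1 = u^-1 * (1 + w^-1) -> u' * v' = u * w * v ->
  geodesic_eq (l ++ [:: u, w, v & r]) (l ++ [:: u', v' & r]).
Proof.
move=> u'E uvE; split=> [|s _].
  by rewrite !big_cat !big_cons /=; congr (_ * _); rewrite !mulrA uvE.
rewrite !geodesicE; congr (_ * _); elim: l => [|t l IHl] /=; last by rewrite IHl.
have uvV : u'^-1 * v'^-1 = u^-1 * w^-1 * v^-1 by rewrite -!invfM uvE.
rewrite !mulrDr !mulr1 !mulrA uvV u'E; ring.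
Qed.

End Geodesic.

(** * The ribbon graph of the reduced quiver *)

(** Gives an orbit of s explicitly, through a function f that computes, once f
is seen to return to h. *)
Lemma porbit_traject_loop (T : finType) (s : {perm T}) (f : T -> T) h n :
  s =1 f -> iter n.+1 f h = h -> porbit s h =i traject f h n.+1.
Proof.
move=> sf loop g; apply/porbitP/trajectP => [[i ->]|[i _ ->]]; last first.
  by exists i; rewrite permX (eq_iter sf).
have lp : looping f h n.+1 by rewrite /looping loop mem_head.
by rewrite permX (eq_iter sf); apply/trajectP/loopingP.
Qed.

(** The finite verifications below run over explicit lists, which compute, in
contrast to the enumeration of a finite type. *)
Lemma mem_indices6 i : i \in indices6.
Proof. by case: i => [[|[|[|[|[|[|?]]]]]] ?]. Qed.

Definition all_red : seq red_vertex :=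
  [seq reda i | i <- indices6] ++ [seq redbeta i | i <- indices6].
Lemma mem_all_red v : v \in all_red.
Proof.
rewrite mem_cat; case: v => i; first by rewrite (map_f reda) ?mem_indices6.
by rewrite (map_f redbeta) ?mem_indices6 ?orbT.
Qed.

(** The two half-edges of an edge: that of a_i with sign true lies in the triangle
(a_i, a_(i+1), beta_i), that with sign false in (a_(i-1), a_i, beta_(i-1)); that
of beta_i with sign true lies in (a_i, a_(i+1), beta_i), that with sign false in
the triangle of all beta_j with j of the parity of i. *)
Definition red_half : finType := (red_vertex * bool)%type.

Definition all_half : seq red_half :=
  [seq (v, true) | v <- all_red] ++ [seq (v, false) | v <- all_red].
Lemma mem_all_half h : h \in all_half.
Proof.
case: h => v s; rewrite mem_cat; case: s.
  by rewrite (map_f (pair^~ true)) ?mem_all_red.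
by rewrite (map_f (pair^~ false)) ?mem_all_red ?orbT.
Qed.

Lemma card_all_half (P : pred red_half) : #|[set h | P h]| = count P all_half.
Proof.
rewrite cardsE cardE -size_filter; apply/perm_size/uniq_perm.
- exact: enum_uniq.
- by rewrite filter_uniq //; vm_compute.
- by move=> h; rewrite mem_enum mem_filter mem_all_half andbT.
Qed.

(** The triangles: inl i is (a_i, a_(i+1), beta_i), and inr true and inr false are
the triangles of the beta_j with j odd and with j even. *)
Definition red_node : finType := ('Z_6 + bool)%type.
Definition red_node_of (h : red_half) : red_node :=
  match h with
  | (inl i, true) => inl i
  | (inl i, false) => inl (i - 1)
  | (inr i, true) => inl i
  | (inr i, false) => inr (odd i)
  end.

(** Each half-edge is followed by the next corner of its triangle, along the
arrows of the quiver. *)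
Definition red_succ (h : red_half) : red_half :=
  match h with
  | (inl i, true) => (reda (i + 1), false)
  | (inl i, false) => (redbeta (i - 1), true)
  | (inr i, true) => (reda i, true)
  | (inr i, false) => (redbeta (i + 2), false)
  end.

Definition red_flip (h : red_half) : red_half := (h.1, ~~ h.2).

Lemma red_succ3 h : red_succ (red_succ (red_succ h)) = h.
Proof. by apply/eqP; move: h (mem_all_half h); apply/allP; vm_compute. Qed.

Lemma red_flip2 : involutive red_flip.
Proof. by case=> v s; rewrite /red_flip negbK. Qed.

Lemma red_succ_inj : injective red_succ.
Proof. exact: (can_inj (g := red_succ \o red_succ) red_succ3). Qed.

Definition red_next : {perm red_half} := perm red_succ_inj.
Definition red_opp : {perm red_half} := perm (can_inj red_flip2).

Lemma red_nextP h :
  porbit red_next h = [set h' | red_node_of h' == red_node_of h].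
Proof.
apply/setP=> h'.
rewrite (porbit_traject_loop (n := 2) (permE _) (red_succ3 h)) inE.
apply/eqP; move: h' (mem_all_half h'); apply/allP.
by move: h (mem_all_half h); apply/allP; vm_compute.
Qed.

Lemma red_oppP h : porbit red_opp h = [set h' | h'.1 == h.1].
Proof.
apply/setP=> h'.
rewrite (porbit_traject_loop (n := 1) (permE _) (red_flip2 h)) !inE.
by case: h h' => [v s] [v' s']; rewrite /red_flip !xpair_eqE; case: eqP;
  case: s s' => [] [].
Qed.

Lemma red_edge_card (v : red_vertex) : #|[set h : red_half | h.1 == v]| = 2%N.
Proof.
rewrite card_all_half; apply/eqP; move: v (mem_all_red v).
by apply/allP; vm_compute.
Qed.

Definition red_graph : ribbon_graph :=
  RibbonGraph red_nextP red_oppP red_edge_card.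

Lemma red_graph_trivalent : trivalent red_graph.
Proof.
have nodeP : {subset predT <= [seq red_node_of h | h <- all_half]}.
  case=> [i _|b _].
    by apply/mapP; exists (reda i, true); rewrite ?mem_all_half.
  by apply/mapP; exists (redbeta b%:R, false); rewrite ?mem_all_half //; case: b.
move=> v; rewrite card_all_half; have /mapP[h hin ->] := nodeP v isT.
by apply/eqP; move: h hin; apply/allP; vm_compute.
Qed.

Lemma red_graph_adjacency u v :
  adjacency_quiver (G := red_graph) u v = red_quiver u v.
Proof.
rewrite /adjacency_quiver card_all_half.
under eq_count => h do rewrite permE.
apply/eqP; move: v (mem_all_red v); apply/allP.
by move: u (mem_all_red u); apply/allP; vm_compute.
Qed.

Definition red_face (h : red_half) : red_half := red_succ (red_flip h).

(** The face through the half-edges (a_i, false) visits only these, in the order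
of i, and closes up after 6 steps.  The other one goes (a_i, true),
(beta_(i-1), true), (beta_(i+1), false), (a_(i+1), true), and so closes up
after 3 * 6 steps. *)
Lemma red_graph_boundary : boundary_number red_graph = 2%N.
Proof.
pose s := (red_opp * red_next)%g.
have sE : s =1 red_face by move=> h; rewrite permM !permE.
pose h1 : red_half := (reda 0, false); pose h2 : red_half := (reda 0, true).
have o1 : porbit s h1 =i traject red_face h1 6.
  by apply: porbit_traject_loop => //; apply/eqP; vm_compute.
have o2 : porbit s h2 =i traject red_face h2 18.
  by apply: porbit_traject_loop => //; apply/eqP; vm_compute.
have cover h : (h \in porbit s h1) || (h \in porbit s h2).
  rewrite o1 o2; move: h (mem_all_half h).
  by apply/allP; vm_compute.
have neq : porbit s h1 != porbit s h2.
  apply/eqP => e; have := porbit_id s h2; rewrite -e o1.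
  by apply/negP; vm_compute.
suff -> : boundary_number red_graph = #|[set porbit s h1; porbit s h2]|.
  by rewrite cards2 neq.
congr #|pred_of_set _|; apply/setP => O; rewrite !inE;
  apply/imsetP/orP => [[h _ ->]|].
  case/orP: (cover h); rewrite -eq_porbit_mem => /eqP ->;
    rewrite eqxx; [by left|by right].
by case=> /eqP ->; eexists.
Qed.

Lemma red_graph_adj_flip (h : red_half) :
  connect (@rg_adj red_graph) (red_node_of h) (red_node_of (red_flip h)).
Proof.
apply: connect1; apply/existsP; exists h.
by rewrite /= permE !eqxx.
Qed.

(** Crossing the edge a_(n+1) leads from the triangle with index n to the next
one, and crossing beta_i leads from the triangle with index i to the one of the
beta_j with j of the parity of i; i = 0 and i = 1 cover both parities. *)
Lemma red_graph_connected : rg_connected red_graph.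
Proof.
split; first by apply/card_gt0P; exists (inl 0).
have adjC : connect_sym (@rg_adj red_graph).
  apply: sym_connect_sym => v w; apply/existsP/existsP => -[h /andP[hv hw]];
  by move: hw; rewrite /= permE => hw; exists (red_flip h);
    rewrite permE red_flip2 hw hv.
have toA (i : 'Z_6) : connect (@rg_adj red_graph) (inl 0) (inl i).
  suff H n : connect (@rg_adj red_graph) (inl 0) (inl n%:R).
    by rewrite -(natr_Zp i).
  elim: n => [|n IHn]; first exact: connect0.
  apply: connect_trans IHn _.
  have := red_graph_adj_flip (reda n.+1%:R, false).
  by rewrite /red_flip /= mulrSr addrK.
have toN v : connect (@rg_adj red_graph) (inl 0) v.
  case: v => [i|b]; first exact: toA.
  apply: connect_trans (toA b%:R) _.
  by have := red_graph_adj_flip (redbeta b%:R, true); case: b.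
by move=> v w; apply: connect_trans (toN w); rewrite adjC.
Qed.

Lemma red_graph_genus : has_genus red_graph 2.
Proof.
split; first exact: red_graph_connected.
by rewrite red_graph_boundary !card_sum !card_ord card_bool.
Qed.

(** * Exchange matrices of the original and the reduced quiver *)

(** The exponent of c_1 in the reduced variables: mutation contributes the
positive part, and the factor -c_1' = -c_1^-1 at b_1 and b_4 lowers it by one. *)
Definition red_exponent (i : A6_vertex) : int :=
  pos_part (exchange A6_quiver i (A6c 1)) - (i \in [:: A6b 1; A6b 4])%:Z.

Definition red_sign (i : A6_vertex) : nat := (i \in [:: A6b 1; A6b 4]).

Lemma red_exchange (u v : red_vertex) :
  exchange A6_quiver (inl u) (inl v)
    + red_exponent (inl v) * exchange A6_quiver (inl u) (A6c 1)
    - red_exponent (inl u) * exchange A6_quiver (inl v) (A6c 1)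
  = exchange red_quiver u v.
Proof.
apply/eqP; move: v (mem_all_red v); apply/allP.
by move: u (mem_all_red u); apply/allP; vm_compute.
Qed.

Lemma red_exchange_c (j : 'Z_3) (v : red_vertex) : j != 1 ->
  exchange A6_quiver (A6c j) (inl v)
    + red_exponent (inl v) * exchange A6_quiver (A6c j) (A6c 1)
    - red_exponent (A6c j) * exchange A6_quiver (inl v) (A6c 1)
  = 0.
Proof.
move=> j1; apply/eqP; move: v (mem_all_red v); apply/allP.
have : j \in [:: 2; 3] by move: j1; case: j => [[|[|[|?]]] ?].
by move: j {j1}; apply/allP; vm_compute.
Qed.

(** * The reduction *)

Theorem mainTheorem3 (K : fieldType) (x : A6_vertex -> K)
    (x_neq0 : forall v, x v != 0) (c1_neqN1 : x (A6c 1) != -1) :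
  let x' := seed_var (mutate (A6c 1) (Seed A6_quiver x)) in
  let a i := x (A6a i) in
  let b i := x (A6b i) in
  let c i := x (A6c i) in
  let a' i := x' (A6a i) in
  let b' i := x' (A6b i) in
  let c' i := x' (A6c i) in
  let bt1 := - c' 1 * b' 1 in
  let bt4 := - c' 1 * b' 4 in
  let y (v : red_vertex) :=
    match v with
    | inl i => a' i
    | inr i => if i == 1 then bt1 else if i == 4 then bt4 else b' i
    end in
  [/\ (c 1 * c 2 * c 3 = 1 /\ 1 + (c 2)^-1 + (c 2 * c 3)^-1 = 0) <->
      (c' 2 * c' 3 = 1 /\ (1 + (c' 1)^-1) * (1 + (c' 2)^-1) = 0),
      c' 1 != -1 &
      (c' 2 * c' 3 = 1 /\ (1 + (c' 1)^-1) * (1 + (c' 2)^-1) = 0) <->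
      (c' 2 = -1 /\ c' 3 = -1)] /\
  (c' 2 = -1 -> c' 3 = -1 ->
    [/\ geodesic_eq [:: a 6; b 5; c 3; b 1; a 1] [:: a' 6; b' 5; bt1; a' 1],
        geodesic_eq [:: a 1; b 6; c 1; b 2; a 2] [:: a' 1; b' 6; b' 2; a' 2],
        geodesic_eq [:: a 2; b 1; c 2; b 3; a 3] [:: a' 2; bt1; b' 3; a' 3] &
    [/\ geodesic_eq [:: a 3; b 2; c 3; b 4; a 4] [:: a' 3; b' 2; bt4; a' 4],
        geodesic_eq [:: a 4; b 3; c 1; b 5; a 5] [:: a' 4; b' 3; b' 5; a' 5] &
        geodesic_eq [:: a 5; b 4; c 2; b 6; a 6] [:: a' 5; bt4; b' 6; a' 6]]]) /\
  (forall pb : K -> K -> K, is_poisson pb -> log_canonical pb A6_quiver x ->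
    (forall v, pb (c' 2) (y v) = 0 /\ pb (c' 3) (y v) = 0) /\
    log_canonical pb red_quiver y) /\
  (exists (G : ribbon_graph) (f : red_vertex -> rg_edge G),
    [/\ bijective f,
        forall u v, adjacency_quiver (f u) (f v) = red_quiver u v,
        trivalent G, has_genus G 2 & boundary_number G = 2%N]).
Proof.
move=> x' a b c a' b' c' bt1 bt4 y.
have c10 : c 1 != 0 by apply: x_neq0.
have c11 : 1 + c 1 != 0 by rewrite addrC addr_eq0.
have x'E i n : exchange A6_quiver i (A6c 1) = n -> i != A6c 1 ->
    x' i = x i * (c 1 ^ pos_part n * (1 + c 1) ^ (- n)).
  by move=> <- i1; apply: mutate_varE.
have c'1 : c' 1 = (c 1)^-1 by rewrite /c' /x' /= /mutate_var eqxx.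
have c'2 : c' 2 = c 2 * (1 + c 1).
  by rewrite /c' (x'E _ (-1)) // expr0z mul1r expr1z.
have c'3 : c' 3 = c 3 * (c 1 / (1 + c 1)).
  by rewrite /c' (x'E _ 1) // expr1z exprN1.
have a'E i : a' i = a i.
  rewrite /a' (x'E _ 0) // ?expr0z ?mulr1 //.
  by apply/eqP; move: i (mem_indices6 i); apply/allP; vm_compute.
have b'in i : i \in [:: 3; 6] -> b' i = b i * (c 1 / (1 + c 1)).
  move=> i36; rewrite /b' (x'E _ 1) ?expr1z ?exprN1 //.
  by apply/eqP; move: i i36; apply/allP; vm_compute.
have b'out i : i \in [:: 2; 5] -> b' i = b i * (1 + c 1).
  move=> i25; rewrite /b' (x'E _ (-1)) ?expr0z ?mul1r ?expr1z //.
  by apply/eqP; move: i i25; apply/allP; vm_compute.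
have b'fix i : i \in [:: 1; 4] -> b' i = b i.
  move=> i14; rewrite /b' (x'E _ 0) ?expr0z ?mulr1 //.
  by apply/eqP; move: i i14; apply/allP; vm_compute.
have c'1N1 : c' 1 != -1.
  apply/eqP => e; move/eqP: c1_neqN1; apply.
  by rewrite -[x _]invrK -/(c 1) -c'1 e invrN1.
have locus : (c' 2 * c' 3 = 1 /\ (1 + (c' 1)^-1) * (1 + (c' 2)^-1) = 0) <->
             (c' 2 = -1 /\ c' 3 = -1).
  split=> [[p23 /eqP]|[-> ->]]; last by rewrite mulrNN mulr1 invrN1 subrr mulr0.
  rewrite c'1 invrK mulf_eq0 (negPf c11) addrC addr_eq0 => /eqP e2.
  have c2N1 : c' 2 = -1 by rewrite -(invrK (c' 2)) e2 invrN1.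
  by split=> //; move: p23; rewrite c2N1 mulN1r => <-; rewrite opprK.
split; [split=> // | split; [|split]].
- have c20 : c 2 != 0 by apply: x_neq0.
  have c30 : c 3 != 0 by apply: x_neq0.
  have -> : c' 2 * c' 3 = c 1 * c 2 * c 3 by rewrite c'2 c'3; field.
  (* Where c_1 c_2 c_3 = 1 the two second conditions have equal left-hand
     sides, because 1/(c_2 c_3) = c_1. *)
  suff E : c 1 * c 2 * c 3 = 1 ->
      (1 + (c' 1)^-1) * (1 + (c' 2)^-1) = 1 + (c 2)^-1 + (c 2 * c 3)^-1.
    by split=> -[p123 e]; split=> //; [rewrite E|rewrite -E].
  move=> p123; have -> : (c 2 * c 3)^-1 = c 1.
    by rewrite -[RHS](mulfK (mulf_neq0 c20 c30)) mulrA p123 mul1r.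
  by rewrite c'1 c'2; field; rewrite c20 c11 c10 oner_neq0.
- move=> e2 e3.
  have c2E : c 2 = - (1 + c 1)^-1.
    by rewrite -mulN1r -e2 c'2 mulfK.
  have c3E : c 3 = - ((1 + c 1) / c 1).
    by rewrite -mulN1r -e3 c'3; field; rewrite c10 c11.
  have bN0 i : b i != 0 by apply: x_neq0.
  (* With all entries written in the b_i and c_1, each identity is the
     contraction of the three entries between the two a_i. *)
  rewrite /bt1 /bt4 !a'E c'1 (b'fix 1) // (b'fix 4) // (b'in 3) // (b'in 6) //.
  rewrite (b'out 2) // (b'out 5) // c2E c3E.
  split; [| | | split]; apply: (@geodesic_contract K [:: _] [:: _]); field.
  all: rewrite ?oppr_eq0 ?c10 ?c11 ?bN0 ?oner_neq0 //.
- move=> pb pbP pbx.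
  pose z := twist A6_quiver x (A6c 1) red_sign red_exponent.
  have zx' i : i \notin [:: A6b 1; A6b 4] -> i != A6c 1 -> x' i = z i.
    move=> iN i1; rewrite (x'E i _ erefl i1) /z /twist /red_sign /red_exponent.
    by rewrite (negPf iN) subr0 expr0 mul1r.
  have zbt i : i \in [:: A6b 1; A6b 4] -> - c' 1 * x' i = z i.
    move=> iN; rewrite /z /twist /red_sign /red_exponent iN c'1.
    rewrite (x'E i _ erefl); last by move: i iN; apply/allP.
    by rewrite expfzDr // exprN1 expr1 -/(c 1); ring.
  have yE v : y v = z (inl v).
    case: v => i /=; first by apply: zx'.
    case: eqP => [->|/eqP i1]; first exact: zbt.
    case: eqP => [->|/eqP i4]; first exact: zbt.
    by apply: zx'; rewrite // !inE negb_or; apply/andP; split.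
  have cE j : j != 1 -> c' j = z (A6c j) by move=> j1; apply: zx'.
  have pbz := poisson_twist pbP pbx red_sign red_exponent _ _ c10 c11.
  split=> [v|u v]; last by rewrite !yE pbz red_exchange.
  by rewrite yE !cE // !pbz !red_exchange_c // !mul0r.
- exists red_graph, id; split.
  + by exists id.
  + exact: red_graph_adjacency.
  + exact: red_graph_trivalent.
  + exact: red_graph_genus.
  + exact: red_graph_boundary.
Qed.
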